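(* Let $K$ be a commutative field, let $\Gamma$ be a subgroup of $\operatorname{Aut}(K)$, and let $k=\{a\in K:\sigma(a)=a \text{ for all }\sigma\in\Gamma\}$ be the invariant field of $\Gamma$. Let $\Gamma$ act on $P^n(K)$ by $\sigma((x_i)_{0\le i\le n})=(\sigma(x_i))_{0\le i\le n}$. Then the $k$-irrationality degree $\operatorname{Irr}_k$ and the $k$-irrationality codegree $\operatorname{Irr}_k^{\ast}$ (defined in the context by means of a choice of permutation) are well-defined; that is, for every subspace $X$ of $P^n(K)$, of dimension $m$ say, the integers $$\dim_k [X]_{j_0\cdots j_n}-\dim_k\left([X]_{j_0\cdots j_n}\cap k^{m+1}\right)\quad\text{and}\quad \dim_k [X]^{\ast}_{j_0\cdots j_n}-\dim_k\left([X]^{\ast}_{j_0\cdots j_n}\cap k^{n-m}\right)$$ do not depend on the choice of the permutation $j_0\cdots j_n$ of $0\cdots n$ with $X_{j_0\cdots j_m}\neq 0$. Moreover, for every subspace $V$ of $P^n(K)$, $$\dim\bigvee_{\sigma\in\Gamma}\sigma(V)=\dim V+\operatorname{Irr}_k V,\qquad \dim\bigcap_{\sigma\in\Gamma}\sigma(V)=\dim V-\operatorname{Irr}_k^{\ast} V,$$ where $\bigvee$ denotes the join and $\bigcap$ the meet (intersection) of subspaces of $P^n(K)$.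
   Context: $P^n(K)$ is the standard projective space of dimension $n$ over $K$, i.e. the set of classes of $K^{n+1}\setminus\{\mathbf 0\}$ modulo nonzero scalars, with points written in homogeneous coordinates $(x_i)_{0\le i\le n}$. A subspace $X$ of $P^n(K)$ is the image of $X'\setminus\{\mathbf 0\}$ for a $K$-linear subspace $X'$ of $K^{n+1}$, and $\dim X=\dim_K X'-1$ (so the empty subspace has dimension $-1$). The join of a family of subspaces is the smallest subspace containing all of them. Each $\sigma(V)$ is a subspace of the same dimension as $V$. Plücker coordinates: for an $m$-dimensional subspace $X$ of $P^n(K)$, choose a basis $v_0,\ldots,v_m$ of $X'$, $v_a=(v_{a,i})_{0\le i\le n}$, and set $X_{i_0\cdots i_m}=\det(v_{a,i_b})_{0\le a,b\le m}$ for all indices $i_0,\ldots,i_m\in\{0,\ldots,n\}$. These are defined up to a common nonzero scalar factor (so their ratios are well-defined), are alternating in the indices, and are not all zero. (For the empty subspace, $m=-1$, the single Plücker coordinate is a nonzero scalar.) Let $X$ be an $m$-dimensional subspace and $j_0\cdots j_n$ a permutation of $0\cdots n$ with $X_{j_0\cdots j_m}\ne 0$. Let $[X]_{j_0\cdots j_n}$ be the $k$-linear span of the subset $$\left\{\left(\frac{X_{j_0\cdots j_{s-1}j_tj_{s+1}\cdots j_m}}{X_{j_0\cdots j_m}}\right)_{0\le s\le m}: m+1\le t\le n\right\}\subseteq K^{m+1},$$ and let $[X]^{\ast}_{j_0\cdots j_n}$ be the $k$-linear span of the subset $$\left\{\left(\frac{X_{j_0\cdots j_{t-1}j_sj_{t+1}\cdots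 j_m}}{X_{j_0\cdots j_m}}\right)_{m+1\le s\le n}: 0\le t\le m\right\}\subseteq K^{n-m}.$$ (In the first, the index $j_s$ in position $s$ is replaced by $j_t$; in the second, the index $j_t$ in position $t$ is replaced by $j_s$.) The $k$-irrationality degree and codegree of $X$ are $$\operatorname{Irr}_k X=\dim_k [X]_{j_0\cdots j_n}-\dim_k\left([X]_{j_0\cdots j_n}\cap k^{m+1}\right),$$ $$\operatorname{Irr}_k^{\ast} X=\dim_k [X]^{\ast}_{j_0\cdots j_n}-\dim_k\left([X]^{\ast}_{j_0\cdots j_n}\cap k^{n-m}\right).$$ *)

(* Defs.v *)
From mathcomp Require Import all_boot all_order all_algebra perm.
From mathcomp Require Import boolp classical_sets.

Set Implicit Arguments.
Unset Strict Implicit.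
Unset Printing Implicit Defensive.

Import GRing.Theory.
Local Open Scope ring_scope.
Local Open Scope classical_set_scope.

(** Subgroups of Aut(K), not necessarily finite.  [Gamma] is a set of ring
    endomorphisms of [K]; [aut_inv] makes its members bijective. *)
Record aut_subgroup (K : fieldType) (Gamma : set {rmorphism K -> K}) : Prop := {
  aut_id : Gamma (idfun : {rmorphism K -> K});
  aut_comp : forall s t : {rmorphism K -> K},
    Gamma s -> Gamma t -> Gamma (s \o t : {rmorphism K -> K});
  aut_inv : forall s : {rmorphism K -> K}, Gamma s ->
    exists t : {rmorphism K -> K}, [/\ Gamma t, cancel s t & cancel t s]
}.

Definition invariant_field (K : fieldType) (Gamma : set {rmorphism K -> K}) :
  set K := [set a | forall s, Gamma s -> s a = a].

Section ProjectiveSpace.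
Variables (K : fieldType) (n : nat).

Definition nzvec := {x : 'rV[K]_n.+1 | x != 0}.

Definition scale_rel : rel nzvec :=
  fun x y => `[< exists2 c : K, c != 0 & val y = c *: val x >].

Lemma scale_rel_refl : reflexive scale_rel.
Proof. by move=> x; apply/asboolP; exists 1; rewrite ?oner_eq0 ?scale1r. Qed.

Lemma scale_rel_sym : symmetric scale_rel.
Proof.
suff sub x y : scale_rel x y -> scale_rel y x by move=> x y; apply/idP/idP => /sub.
move=> /asboolP[c c0 e]; apply/asboolP; exists c^-1; first by rewrite invr_eq0.
by rewrite e scalerA mulVf // scale1r.
Qed.

Lemma scale_rel_trans : transitive scale_rel.
Proof.
move=> y x z /asboolP[c c0 ec] /asboolP[d d0 ed]; apply/asboolP.
by exists (d * c); rewrite ?mulf_neq0 // ed ec scalerA.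
Qed.

Canonical scale_equiv :=
  EquivRel scale_rel scale_rel_refl scale_rel_sym scale_rel_trans.

Definition proj_space := {eq_quot scale_rel}%qT.

Definition proj_class (x : nzvec) : proj_space := (\pi_({eq_quot scale_rel}) x)%qT.

Lemma proj_classP (x y : nzvec) :
  proj_class x = proj_class y <-> exists2 c : K, c != 0 & val y = c *: val x.
Proof.
rewrite /proj_class; split=> [/eqquotP/asboolP//|e].
by apply/eqquotP/asboolP.
Qed.

Lemma map_nzvec_proof (s : {rmorphism K -> K}) (x : nzvec) :
  map_mx s (val x) != 0.
Proof. by rewrite map_mx_eq0; exact: (valP x). Qed.

Definition map_nzvec (s : {rmorphism K -> K}) (x : nzvec) : nzvec :=
  exist _ (map_mx s (val x)) (map_nzvec_proof s x).

Definition proj_act (s : {rmorphism K -> K}) (p : proj_space) : proj_space :=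
  proj_class (map_nzvec s (repr p)).

Lemma proj_actE (s : {rmorphism K -> K}) (x : nzvec) :
  proj_act s (proj_class x) = proj_class (map_nzvec s x).
Proof.
have /proj_classP[c c0 e] : proj_class (repr (proj_class x)) = proj_class x.
  by rewrite /proj_class reprK.
apply/proj_classP; exists (s c); first by rewrite fmorph_eq0.
by rewrite /= e map_mxZ.
Qed.

Definition proj_image (U : {vspace 'rV[K]_n.+1}) : set proj_space :=
  [set proj_class x | x in [set x : nzvec | val x \in U]].

Definition is_subspace (X : set proj_space) : Prop :=
  exists U : {vspace 'rV[K]_n.+1}, X = proj_image U.

(** The linear subspace X' lying over [X]; it is unique, see [coneK]. *)
Definition cone (X : set proj_space) : {vspace 'rV[K]_n.+1} :=
  xget 0%VS [set U | X = proj_image U].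

Lemma proj_image_sub (U W : {vspace 'rV[K]_n.+1}) :
  proj_image U `<=` proj_image W -> (U <= W)%VS.
Proof.
move=> UW; apply/subvP => x xU; have [->|x0] := eqVneq x 0; first exact: mem0v.
have [|y yW /proj_classP[c _ /= ->]] := UW (proj_class (exist _ x x0)).
  by exists (exist _ x x0).
exact: memvZ.
Qed.

Lemma coneK (U : {vspace 'rV[K]_n.+1}) : cone (proj_image U) = U.
Proof.
rewrite /cone; case: xgetP => [W _ /= e|/(_ U)/(_ erefl)//].
by apply: subv_anti; rewrite !proj_image_sub // e.
Qed.

Definition proj_dim (X : set proj_space) : int := (\dim (cone X))%:Z - 1.

Definition join (F : set (set proj_space)) : set proj_space :=
  smallest is_subspace (\bigcup_(X in F) X).

End ProjectiveSpace.

(** Linear algebra over a subfield [k] of [K], given as a set, inside K^d. *)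
Section Subfield.
Variables (K : fieldType) (k : set K) (d : nat).

Definition kspan (q : nat) (w : 'I_q -> 'rV[K]_d) : set 'rV[K]_d :=
  [set \sum_(t < q) c t *: w t | c in [set c : 'I_q -> K | forall t, k (c t)]].

Definition kfree (q : nat) (w : 'I_q -> 'rV[K]_d) : Prop :=
  forall c : 'I_q -> K, (forall t, k (c t)) ->
    \sum_(t < q) c t *: w t = 0 -> forall t, c t = 0.

(** Only meaningful on finite-dimensional k-subspaces. *)
Definition kdim (S : set 'rV[K]_d) : nat :=
  xget 0%N [set q | exists w : 'I_q -> 'rV[K]_d, kfree w /\ kspan w = S].

Definition krational : set 'rV[K]_d := [set x | forall i, k (x 0 i)].

End Subfield.

(** Below, r = m + 1 is the length of a basis of X', so that the positions
    0..m are 'I_r, and t : 'I_(n.+1 - r) stands for the position m + 1 + t.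
    Since r <= n.+1, [inord] only injects these positions into 'I_n.+1. *)
Section Plucker.
Variables (K : fieldType) (n r : nat).
Implicit Types (v : r.-tuple 'rV[K]_n.+1) (j : 'S_n.+1) (k : set K).

Definition plucker v (i : 'I_r -> 'I_n.+1) : K :=
  \det (\matrix_(a < r, b < r) tnth v a 0 (i b)).

Definition first_idx j : 'I_r -> 'I_n.+1 := fun s => j (inord s).

Definition last_idx j : 'I_(n.+1 - r) -> 'I_n.+1 := fun t => j (inord (r + t)).

Definition plucker_ratio v j (s : 'I_r) (t : 'I_(n.+1 - r)) : K :=
  plucker v [eta first_idx j with s |-> last_idx j t] / plucker v (first_idx j).

Definition bracket k v j : set 'rV[K]_r :=
  kspan k (fun t : 'I_(n.+1 - r) => \row_(s < r) plucker_ratio v j s t).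

Definition cobracket k v j : set 'rV[K]_(n.+1 - r) :=
  kspan k (fun t : 'I_r => \row_(s < n.+1 - r) plucker_ratio v j t s).

Definition irr_at k v j : int :=
  (kdim k (bracket k v j))%:Z - (kdim k (bracket k v j `&` @krational K k r))%:Z.

Definition coirr_at k v j : int :=
  (kdim k (cobracket k v j))%:Z -
  (kdim k (cobracket k v j `&` @krational K k (n.+1 - r)))%:Z.

End Plucker.

Lemma extend_perm n r (f : 'I_r -> 'I_n.+1) : injective f ->
  exists j : 'S_n.+1, forall s : 'I_r, j (inord s) = f s.
Proof.
move=> fI; pose s1 := codom f; pose s := s1 ++ [seq x <- enum 'I_n.+1 | x \notin s1].
have us : uniq s.
  rewrite cat_uniq filter_uniq ?enum_uniq // andbT.
  apply/andP; split; first exact/injectiveP.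
  by apply/hasPn => x; rewrite mem_filter => /andP[].
have sm x : x \in s by rewrite mem_cat mem_filter mem_enum andbT orbN.
have ss : size s = n.+1.
  rewrite -[RHS](card_ord n.+1) cardE; apply/perm_size/uniq_perm => //.
    exact: enum_uniq.
  by move=> x; rewrite sm mem_enum.
have jI : injective (fun t : 'I_n.+1 => nth ord0 s t).
  by move=> x y /eqP; rewrite nth_uniq ?ss // => /eqP/val_inj.
exists (perm jI) => t; rewrite permE /=.
have rn : (r <= n.+1)%N by rewrite -ss size_cat size_codom card_ord leq_addr.
rewrite inordK; last exact: leq_trans (ltn_ord t) rn.
rewrite nth_cat size_codom card_ord ltn_ord (nth_map t) ?size_enum_ord //.
by rewrite nth_ord_enum.
Qed.

Section Irrationality.
Variables (K : fieldType) (n : nat) (k : set K).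
Implicit Type X : set (proj_space K n).

(** The choices entering the definition of the irrationality degrees: a basis
    of X' and a permutation j with nonzero leading Plucker coordinate. *)
Definition admissible X (v : (\dim (cone X)).-tuple 'rV[K]_n.+1)
    (j : 'S_n.+1) : Prop :=
  basis_of (cone X) v /\ plucker v (first_idx j) != 0.

(** So the sets in [Irr] and [coIrr] are nonempty and the default 0 plays no
    role. *)
Lemma admissible_ex X : exists v j, @admissible X v j.
Proof.
set U := cone X; set r := \dim U; set v := vbasis U; exists v.
pose A := \matrix_(a < r, i < n.+1) tnth v a 0 i.
have bv : basis_of U v by exact: vbasisP.
have fA : row_full A^T.
  rewrite /row_full mxrank_tr -/(row_free A); apply: inj_row_free => u uA.
  have /freeP fv := basis_free bv; apply/rowP => a; rewrite mxE.
  apply: fv; rewrite -[RHS]uA; apply/rowP => i; rewrite summxE !mxE.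
  by apply: eq_bigr => b _; rewrite !mxE (tnth_nth 0).
have [j jE] := extend_perm (@fullrankfun_inj _ _ _ _ fA).
exists j; split=> //; rewrite -unitfE -unitmxE -unitmx_tr.
rewrite -row_full_unit; suff -> : (\matrix_(a, b) tnth v a 0 (first_idx j b))^T
    = rowsub (fullrankfun fA) A^T by exact: fullrowsub_full.
by apply/matrixP => a b; rewrite !mxE /first_idx jE.
Qed.

Definition Irr X : int :=
  xget 0 [set d | exists v j, @admissible X v j /\ d = irr_at k v j].

Definition coIrr X : int :=
  xget 0 [set d | exists v j, @admissible X v j /\ d = coirr_at k v j].

End Irrationality.

(* Main.v *)
Require Import Defs.
From mathcomp Require Import all_boot all_order all_algebra perm.
From mathcomp Require Import boolp classical_sets.

Set Implicit Arguments.
Unset Strict Implicit.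
Unset Printing Implicit Defensive.

Import GRing.Theory.
Local Open Scope ring_scope.
Local Open Scope classical_set_scope.
(** Normalise a basis of X' so that its matrix P is, up to the permutation of
    the coordinates, [1 | A]; by Cramer's rule A is the matrix of Plücker
    ratios.  Then x P lies in every s(X') iff x (s(A) - A) = 0 for all s, and
    the join of the s(X') is the direct sum of X' and the span of the rows of
    all [0 | s(A) - A], so both dimensions are governed by the space C of
    vectors x with x (s(B) - B) = 0 for all s, where B = A, resp. B = A^T.
    This space is stable under Gamma, hence spanned by vectors over k (Galois
    descent), and a vector x over k belongs to C iff x B has entries in k.
    Comparing with the k-span of the rows of B, the codimension of C is the
    irrationality codegree, resp. degree, computed from the chosen basis and
    permutation; since the two projective dimensions do not depend on the
    choices, neither do the degrees. *)

Local Notation rows M := (fun i => row i M).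

(** * Row spaces of matrices over K, and their dictionary with [vspace] *)

Section RowSpaces.
Variable K : fieldType.

(** Choose [C] of maximal rank among the matrices whose row space lies in [S]. Adjoining a vector of
    [S] to [C] stays inside [S], so by maximality that vector already lies in the row space. *)
Lemma linear_set_rowspace p (S : set 'rV[K]_p) :
  S 0 -> (forall a x y, S x -> S y -> S (a *: x + y)) ->
  exists C : 'M[K]_p, forall x : 'rV_p, (x <= C)%MS <-> S x.
Proof.
move=> S0 Slin.
pose Q d := `[< exists C : 'M[K]_p,
  \rank C = d /\ forall x : 'rV_p, (x <= C)%MS -> S x >].
have exQ : exists d, Q d.
  exists 0; apply/asboolP; exists 0; split; first by rewrite mxrank0.
  by move=> x; rewrite submx0 => /eqP->.
have ubQ d : Q d -> (d <= p)%N.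
  by move=> /asboolP[C [<- _]]; exact: rank_leq_col.
case: (ex_maxnP exQ ubQ) => d /asboolP[C [rC CS]] dmax.
exists C => x; split; first exact: CS.
move=> Sx; have /dmax : Q (\rank (C + x)%MS).
  apply/asboolP; exists (C + x)%MS; split=> // y /sub_addsmxP[[u a] ->] /=.
  rewrite addrC [a]mx11_scalar mul_scalar_mx; apply: Slin => //.
  by apply: CS; exact: submxMl.
rewrite -rC => le; apply: submx_trans (addsmxSr C x) _.
by rewrite -(mxrank_leqif_sup (addsmxSl C x)).2 eqn_leq le mxrankS ?addsmxSl.
Qed.

Lemma rowspace_le p m1 m2 (A : 'M[K]_(m1, p)) (B : 'M[K]_(m2, p)) :
  (forall x : 'rV_p, (x <= A)%MS -> (x <= B)%MS) -> (A <= B)%MS.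
Proof. by move=> AB; apply/row_subP => i; apply: AB; exact: row_sub. Qed.

Definition rowvs N m (M : 'M[K]_(m, N)) : {vspace 'rV[K]_N} :=
  <<[tuple row i M | i < m]>>%VS.

Lemma mem_rowvs N m (M : 'M[K]_(m, N)) x : (x \in rowvs M) = (x <= M)%MS.
Proof.
apply/idP/idP => [xM|/submxP[u ->]].
  rewrite (coord_span xM); apply: summx_sub => i _; apply: scalemx_sub.
  by rewrite -tnth_nth tnth_mktuple row_sub.
rewrite mulmx_sum_row; apply: memv_suml => i _; apply: memvZ.
by apply: memv_span; apply/tnthP; exists i; rewrite tnth_mktuple.
Qed.

Lemma eq_rowvs N m1 m2 (A : 'M[K]_(m1, N)) (B : 'M[K]_(m2, N)) :
  (A :=: B)%MS -> rowvs A = rowvs B.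
Proof. by move=> AB; apply/vspaceP => x; rewrite !mem_rowvs AB. Qed.

Lemma dim_rowvs N m (M : 'M[K]_(m, N)) : \dim (rowvs M) = \rank M.
Proof.
rewrite -(eq_rowvs (eq_row_base M)) /rowvs.
have fr := row_base_free M; set B := row_base M in fr *.
suff /eqP -> : free [tuple row i B | i < \rank M] by rewrite size_tuple.
apply/freeP => c c0 i.
have : \row_i c i *m B = 0.
  rewrite mulmx_sum_row -[RHS]c0; apply: eq_bigr => l _.
  by rewrite mxE -tnth_nth tnth_mktuple.
by move=> /eqP; rewrite mulmx_free_eq0 // => /eqP/rowP/(_ i); rewrite !mxE.
Qed.

Definition basis_mx N r (v : r.-tuple 'rV[K]_N) : 'M[K]_(r, N) :=
  \matrix_(a < r) tnth v a.

Lemma rowvs_basis_mx N (U : {vspace 'rV[K]_N}) r (v : r.-tuple 'rV[K]_N) :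
  basis_of U v -> U = rowvs (basis_mx v).
Proof.
move=> /span_basis <-; congr span; congr val.
by apply: eq_from_tnth => i; rewrite tnth_mktuple rowK.
Qed.

End RowSpaces.

(** * Galois descent and dimensions over the invariant field k *)

Section Descent.
Variables (K : fieldType) (Gamma : set {rmorphism K -> K}).
Hypothesis hGamma : aut_subgroup Gamma.
Let k := invariant_field Gamma.

(** Rationality over k, phrased as invariance of the whole matrix so that it passes through products
    and blocks by rewriting; [kmxP] gives the entrywise form. *)
Definition kmx m n (M : 'M[K]_(m, n)) := forall s, Gamma s -> map_mx s M = M.

Lemma kmxP m n (M : 'M[K]_(m, n)) : kmx M <-> forall i j, k (M i j).
Proof.
split=> [kM i j s Gs|kM s Gs]; first by rewrite -[in RHS](kM s Gs) mxE.
by apply/matrixP => i j; rewrite mxE kM.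
Qed.

Lemma kmxM m n p (A : 'M[K]_(m, n)) (B : 'M[K]_(n, p)) :
  kmx A -> kmx B -> kmx (A *m B).
Proof. by move=> kA kB s Gs; rewrite map_mxM kA // kB. Qed.

(* Galois descent, by uniqueness of the reduced echelon form: if some columns
   of R form the identity matrix, then s R = T R forces T = 1. *)
Lemma stable_kbasis p (C : 'M[K]_p) :
  (forall s, Gamma s -> (map_mx s C <= C)%MS) ->
  exists R : 'M[K]_(\rank C, p), [/\ kmx R, row_free R & (R :=: C)%MS].
Proof.
move=> Cst; have fr := row_base_free C; set B := row_base C in fr *.
have fB : row_full B^T by rewrite /row_full mxrank_tr.
(* [f] selects [\rank C] independent columns of [B]; inverting this square block normalises it to
   the identity. *)
pose f := fullrankfun fB.
have u : colsub f B \in unitmx.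
  by rewrite -unitmx_tr -row_full_unit trmx_mxsub fullrowsub_full.
exists (invmx (colsub f B) *m B).
have eR : (invmx (colsub f B) *m B :=: C)%MS.
  apply: (eqmx_trans _ (eq_row_base C)); apply: eqmxMfull.
  by rewrite row_full_unit unitmx_inv.
split=> //; last by rewrite /row_free eR.
set R := _ *m B in eR *.
have R1 : colsub f R = 1%:M by rewrite /R -mulmx_colsub mulVmx.
move=> s Gs.
have /submxP[T eT] : (map_mx s R <= R)%MS.
  rewrite eR; apply: submx_trans (Cst s Gs); rewrite map_submx.
  by rewrite eR.
suff T1 : T = 1%:M by rewrite eT T1 mul1mx.
have := congr1 (colsub f) eT.
by rewrite -map_mxsub R1 map_mx1 -mulmx_colsub R1 mulmx1.
Qed.

Lemma kspan_rowP m d (M : 'M[K]_(m, d)) x :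
  kspan k (rows M) x <-> exists2 c : 'rV_m, kmx c & x = c *m M.
Proof.
split=> [[c kc <-]|[c kc ->]].
  exists (\row_i c i); first by apply/kmxP => i j; rewrite mxE.
  by rewrite mulmx_sum_row; apply: eq_bigr => i _; rewrite mxE.
exists (fun i => c 0 i); first by move=> i; move/kmxP: kc; apply.
by rewrite mulmx_sum_row.
Qed.

Lemma kfree_rowP m d (M : 'M[K]_(m, d)) :
  kfree k (rows M) <-> forall c : 'rV_m, kmx c -> c *m M = 0 -> c = 0.
Proof.
split=> [fM c /kmxP kc|fM c kc] cM.
  apply/rowP => i; rewrite mxE; apply: (fM (c 0)) => //.
  by rewrite -[RHS]cM mulmx_sum_row.
have /fM : kmx (\row_i c i) by apply/kmxP => a b; rewrite mxE.
suff /[swap]/[apply] : \row_i c i *m M = 0.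
  by move=> + i => /rowP/(_ i); rewrite !mxE.
by rewrite mulmx_sum_row -[RHS]cM; apply: eq_bigr => i _; rewrite mxE.
Qed.

Lemma kspan_rows m m' d (M : 'M[K]_(m, d)) (M' : 'M[K]_(m', d)) :
  kspan k (rows M) `<=` kspan k (rows M') ->
  exists2 T : 'M_(m, m'), kmx T & M = T *m M'.
Proof.
move=> MM'.
have /choice[T kT] i : exists c : 'rV_m', kmx c /\ row i M = c *m M'.
  have /MM'/kspan_rowP[c kc e] : kspan k (rows M) (row i M).
    apply/kspan_rowP; exists (delta_mx 0 i); last by rewrite rowE.
    by move=> s Gs; rewrite map_delta_mx.
  by exists c.
exists (\matrix_i T i).
  apply/kmxP => i l; rewrite mxE; have [/kmxP kTi _] := kT i; exact: kTi.
by apply/row_matrixP => i; rewrite row_mul rowK (kT i).2.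
Qed.

Lemma row_matrix_fun m d (w : 'I_m -> 'rV[K]_d) : rows (\matrix_i w i) = w.
Proof. by apply/funext => i; rewrite rowK. Qed.

(** Expressing each family in the other with coefficients in k gives T T' M = M. Freeness over k
    turns this into T T' = 1, and a rank count over K concludes. *)
Lemma kfree_span_le m m' d (M : 'M[K]_(m, d)) (M' : 'M[K]_(m', d)) :
  kfree k (rows M) -> kspan k (rows M) = kspan k (rows M') -> (m <= m')%N.
Proof.
move=> /kfree_rowP fM e.
have [T kT eT] : exists2 T : 'M_(m, m'), kmx T & M = T *m M'.
  by apply: kspan_rows; rewrite e.
have [T' kT' eT'] : exists2 T : 'M_(m', m), kmx T & M' = T *m M.
  by apply: kspan_rows; rewrite e.
suff TT : T *m T' = 1%:M.
  have := mxrankM_maxl T T'; rewrite TT mxrank1 => /leq_trans; apply.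
  exact: rank_leq_col.
apply/subr0_eq/row_matrixP => i; rewrite row0; apply: fM.
  move=> s Gs; rewrite map_row map_mxB map_mxM map_mx1.
  by rewrite kT // kT'.
by rewrite -row_mul mulmxBl mul1mx -mulmxA -eT' -eT subrr row0.
Qed.

Lemma kdim_rows m d (M : 'M[K]_(m, d)) :
  kfree k (rows M) -> kdim k (kspan k (rows M)) = m.
Proof.
move=> fM; rewrite /kdim; case: xgetP => [q _ /= [w [fw ew]]|/(_ m) []]; last first.
  by exists (rows M).
rewrite -(row_matrix_fun w) in fw ew.
by apply/eqP; rewrite eqn_leq (kfree_span_le fw ew) (kfree_span_le fM (esym ew)).
Qed.

(* The K-space of linear relations among the rows of all conjugates of M is
   the scalar extension of the k-space of k-linear relations among the rows
   of M. *)
Lemma kdim_kspan m d (M : 'M[K]_(m, d)) (C : 'M[K]_m) :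
  (forall x : 'rV_m, (x <= C)%MS <->
     forall s, Gamma s -> x *m map_mx s M = 0) ->
  kdim k (kspan k (rows M)) = (m - \rank C)%N.
Proof.
move=> CP.
have Cst s : Gamma s -> (map_mx s C <= C)%MS.
  move=> Gs; apply/row_subP => i; apply/CP => t Gt.
  (* With s' inverse to s, the condition at t for the image under s is the image under s of the
     condition at s' t. *)
  have [s' [Gs' ss' s's]] := aut_inv hGamma Gs.
  have /CP/(_ _ (aut_comp hGamma Gs' Gt)) := row_sub i C.
  move=> /(congr1 (map_mx s)); rewrite map_mxM map_mx0 => e.
  rewrite -map_row -[RHS]e; congr (_ *m _).
  by apply/matrixP => a b; rewrite !mxE /= s's.
have [R [kR fR eR]] := stable_kbasis Cst.
have RM : R *m M = 0.
  apply/row_matrixP => i; rewrite row_mul row0.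
  have /CP/(_ _ (aut_id hGamma)) : (row i R <= C)%MS by rewrite -eR row_sub.
  by rewrite map_mx_id.
(* The unit vectors in [H] give a basis of the quotient of K^m by the row space of [C], so they
   complete [R] to a basis of K^m with entries in k. The rows of [M] selected by [g] will be the
   k-basis sought. *)
pose g := maxrankfun (cokermx C); pose H : 'M[K]_(_, m) := rowsub g 1%:M.
have kH : kmx H by move=> s Gs; rewrite map_mxsub map_mx1.
have HM : H *m M = rowsub g M by rewrite mul_rowsub_mx mul1mx.
have fN : row_free (col_mx R H).
  apply: inj_row_free => x; rewrite -[x]hsubmxK mul_row_col => e.
  have Rc : R *m cokermx C = 0 by apply/eqP; rewrite -submxE eR.
  have /eqP := congr1 (mulmx^~ (cokermx C)) e.
  rewrite mul0mx mulmxDl -!mulmxA Rc mulmx0 add0r mul_rowsub_mx mul1mx.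
  rewrite mulmx_free_eq0 ?maxrowsub_free // => /eqP x0; move/eqP: e.
  by rewrite x0 mul0mx addr0 mulmx_free_eq0 // => /eqP->; rewrite row_mx0.
have [T kT TN] : exists2 T : 'M_(m, _), kmx T & T *m col_mx R H = 1%:M.
  have /row_fullP[T TN] : row_full (col_mx R H).
    by rewrite /row_full (eqP fN) mxrank_coker subnKC // rank_leq_col.
  (* [T] is rational because inverses are unique and the matrix it inverts is fixed by [Gamma]. *)
  exists T => // s Gs; apply: (row_free_inj fN); rewrite /= TN.
  by rewrite -[in LHS](kR s Gs) -[in LHS](kH s Gs) -map_col_mx -map_mxM TN map_mx1.
rewrite -mxrank_coker.
have -> : kspan k (rows M) = kspan k (rows (rowsub g M)).
  apply/seteqP; split=> x /kspan_rowP[c kc ->]; apply/kspan_rowP.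
    exists (rsubmx (c *m T)).
      by move=> s Gs; rewrite map_rsubmx (kmxM kc kT).
    rewrite -[in LHS](mul1mx M) -TN !mulmxA -[c *m T]hsubmxK mul_row_col.
    by rewrite mulmxDl -!mulmxA RM mulmx0 add0r HM hsubmxK.
  by exists (c *m H); [exact: kmxM | rewrite -HM mulmxA].
apply: kdim_rows; apply/kfree_rowP => c kc; rewrite -HM mulmxA => e.
(* As c H is rational, killing [M] implies killing every conjugate of [M], so c H lies in the row
   space of [C]; independence of [R] and [H] then gives c = 0. *)
have /submxP[y ey] : (c *m H <= R)%MS.
  rewrite eR; apply/CP => s Gs.
  by rewrite -(kmxM kc kH Gs) -map_mxM e map_mx0.
have /eqP : row_mx (- y) c *m col_mx R H = 0.
  by rewrite mul_row_col mulNmx -ey addNr.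
by rewrite mulmx_free_eq0 // -row_mx0 => /eqP/eq_row_mx[].
Qed.

(* For x with entries in k, x *m B has entries in k exactly when x is killed
   by all the differences between B and its conjugates. *)
Lemma kdim_rational p q (B : 'M[K]_(p, q)) : exists C : 'M[K]_p,
  (forall x : 'rV_p, (x <= C)%MS <->
     forall s, Gamma s -> x *m (map_mx s B - B) = 0) /\
  (kdim k (kspan k (rows B)))%:Z -
    (kdim k (kspan k (rows B) `&` @krational K k q))%:Z
  = p%:Z - (\rank C)%:Z :> int.
Proof.
have [||C CP] := @linear_set_rowspace K p
  [set x | forall s, Gamma s -> x *m (map_mx s B - B) = 0].
  by move=> s _; rewrite mul0mx.
  by move=> a x y Sx Sy s Gs; rewrite mulmxDl -scalemxAl Sx // Sy // scaler0 addr0.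
(* By [kdim_kspan], the k-span of the rows of [B] has dimension p - rank [C0]. *)
have [||C0 C0P] := @linear_set_rowspace K p
  [set x | forall s, Gamma s -> x *m map_mx s B = 0].
  by move=> s _; rewrite mul0mx.
  by move=> a x y Sx Sy s Gs; rewrite mulmxDl -scalemxAl Sx // Sy // scaler0 addr0.
exists C; split=> //.
have C0C : (C0 <= C)%MS.
  apply: rowspace_le => x /C0P x0; apply/CP => s Gs.
  have := x0 _ (aut_id hGamma); rewrite map_mx_id // => xB.
  by rewrite mulmxBr x0 // xB subrr.
have Cst s : Gamma s -> (map_mx s C <= C)%MS.
  move=> Gs; apply/row_subP => i; apply/CP => t Gt.
  have [s' [Gs' ss' s's]] := aut_inv hGamma Gs.
  have /CP CiP := row_sub i C.
  (* Applying s to the conditions at s' t and at s' shows that row i of s(C) kills t(B) - s(B) and B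
     - s(B), hence t(B) - B. *)
  have /(congr1 (map_mx s)) := CiP _ (aut_comp hGamma Gs' Gt).
  have /(congr1 (map_mx s)) := CiP _ Gs'.
  rewrite !map_mxM !map_mx0 !map_mxB map_row.
  have -> : map_mx s (map_mx s' B) = B by apply/matrixP => a b; rewrite !mxE.
  have -> : map_mx s (map_mx (s' \o t : {rmorphism K -> K}) B) = map_mx t B.
    by apply/matrixP => a b; rewrite !mxE /= s's.
  move=> e1 e2; rewrite -(subrKA (map_mx s B)) mulmxDr e2 add0r.
  by rewrite -opprB mulmxN e1 oppr0.
have [R [kR fR eR]] := stable_kbasis Cst.
have RP s : Gamma s -> R *m map_mx s B = R *m B.
  move=> Gs; apply/subr0_eq/row_matrixP => i.
  rewrite -mulmxBr row_mul row0; have /CP : (row i R <= C)%MS by rewrite -eR row_sub.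
  exact.
have kRB : kmx (R *m B) by move=> s Gs; rewrite map_mxM kR // RP.
have -> : kspan k (rows B) `&` @krational K k q = kspan k (rows (R *m B)).
  apply/seteqP; split=> x.
    move=> [/kspan_rowP[c kc ->] kx].
    have kcB : kmx (c *m B) by apply/kmxP => i l; rewrite ord1.
    have /submxP[y ey] : (c <= R)%MS.
      rewrite eR; apply/CP => s Gs.
      by rewrite mulmxBr -[in X in X - _](kc s Gs) -map_mxM kcB // subrr.
    apply/kspan_rowP; exists y; last by rewrite ey mulmxA.
    (* Coordinates with respect to the free rational matrix [R] are unique, so those of the rational
       vector [c] are rational. *)
    move=> s Gs; apply: (row_free_inj fR); rewrite /= -ey.
    by rewrite -[in LHS](kR s Gs) -map_mxM -ey kc.
  move=> /kspan_rowP[c kc ->]; split.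
    by apply/kspan_rowP; exists (c *m R); [exact: kmxM | rewrite mulmxA].
  by move=> i; move/kmxP: (kmxM kc kRB); exact.
rewrite (kdim_kspan C0P) (@kdim_kspan _ _ _ (kermx (R *m B))); last first.
  move=> x; rewrite sub_kermx; split=> [/eqP e s Gs|e]; first by rewrite kRB.
  by have := e _ (aut_id hGamma); rewrite map_mx_id // => ->.
(* Multiplication by [R] maps the kernel of R B isomorphically onto [C0], since [C0] lies in the row
   space of [R] and R s(B) = R B. The two dimensions thus differ by (p - rank C0) - (rank C - rank
   C0). *)
have -> : \rank C0 = \rank (kermx (R *m B)).
  rewrite -(mxrankMfree (kermx _) fR); apply: eqmx_rank; apply/andP; split.
    apply: rowspace_le => x xC0.
    have /submxP[y ey] : (x <= R)%MS by rewrite eR (submx_trans xC0).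
    rewrite ey submxMr // sub_kermx mulmxA -ey.
    by move/C0P/(_ _ (aut_id hGamma)): xC0; rewrite map_mx_id // => ->.
  apply: rowspace_le => x /submxP[y ->]; apply/C0P => s Gs.
  by rewrite -mulmxA -[X in _ *m X]mulmxA RP // mulmx_ker mulmx0.
rewrite mxrank_ker subKn ?rank_leq_row //.
have r1 : (\rank (R *m B) <= \rank C)%N by exact: rank_leq_row.
have r2 : (\rank C <= p)%N by exact: rank_leq_col.
rewrite -subzn; last by rewrite (leq_trans (leq_subr _ _)).
by rewrite -subzn // opprB addrA addrAC addrK.
Qed.

End Descent.

(** * Projective subspaces as images of row spaces, and the action on them *)

Section ProjectiveSubspaces.
Variables (K : fieldType) (n : nat).

Lemma proj_imageP (U : {vspace 'rV[K]_n.+1}) (x : nzvec K n) :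
  proj_image U (proj_class x) <-> val x \in U.
Proof.
split=> [[y yU /proj_classP[c _ ->]]|xU]; first exact: memvZ.
by exists x.
Qed.

Lemma eq_proj_set (X Y : set (proj_space K n)) :
  (forall x, X (proj_class x) <-> Y (proj_class x)) -> X = Y.
Proof.
move=> XY; apply/seteqP; split=> p; rewrite -[p]reprK; exact: (XY _).1 || exact: (XY _).2.
Qed.

Lemma proj_image_mono (U W : {vspace 'rV[K]_n.+1}) :
  (U <= W)%VS -> proj_image U `<=` proj_image W.
Proof. by move=> /subvP UW _ [x xU <-]; exists x => //; apply: UW. Qed.

Lemma proj_act_rowvs (s t : {rmorphism K -> K}) m (M : 'M[K]_(m, n.+1)) :
  cancel t s ->
  proj_act s @` proj_image (rowvs M) = proj_image (rowvs (map_mx s M)).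
Proof.
move=> ts; have tsM a b (A : 'M_(a, b)) : map_mx s (map_mx t A) = A.
  by apply/matrixP => i j; rewrite !mxE ts.
apply/seteqP; split=> p.
  move=> [_ [x xM <-] <-]; rewrite proj_actE; apply/proj_imageP.
  by move: xM; rewrite /= !mem_rowvs map_submx.
move=> [x xM <-]; exists (proj_class (map_nzvec t x)).
  by apply/proj_imageP; rewrite /= mem_rowvs -(map_submx s) tsM -mem_rowvs.
by rewrite proj_actE; congr proj_class; apply: val_inj; rewrite /= tsM.
Qed.

Lemma proj_dim_rowvs m (M : 'M[K]_(m, n.+1)) :
  proj_dim (proj_image (rowvs M)) = (\rank M)%:Z - 1.
Proof. by rewrite /proj_dim coneK dim_rowvs. Qed.

End ProjectiveSubspaces.

(** * Normalised bases and Plücker ratios *)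

Section Coordinates.
Variables (K : fieldType) (n r : nat).
Implicit Types (v : r.-tuple 'rV[K]_n.+1) (j : 'S_n.+1).

Local Notation first := (@first_idx n r).
Local Notation last := (@last_idx n r).

Definition pivot_mx v j : 'M[K]_r := colsub (first j) (basis_mx v).

Definition ratio_mx v j : 'M[K]_(r, n.+1 - r) :=
  \matrix_(s, t) plucker_ratio v j s t.

(** This is the matrix [1 | A] up to the order of the coordinates: its row space is the graph of x
    -> x A, with A = [ratio_mx v j]. *)
Definition graph_mx v j : 'M[K]_(r, n.+1) := invmx (pivot_mx v j) *m basis_mx v.

Lemma pluckerE v i : plucker v i = \det (colsub i (basis_mx v)).
Proof. by congr (\det _); apply/matrixP => a b; rewrite !mxE. Qed.

Lemma pivot_unit v j : plucker v (first j) != 0 -> pivot_mx v j \in unitmx.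
Proof. by rewrite pluckerE unitmxE unitfE. Qed.

Lemma colsub_first_graph v j : plucker v (first j) != 0 ->
  colsub (first j) (graph_mx v j) = 1%:M.
Proof. by move=> /pivot_unit u; rewrite /graph_mx -mulmx_colsub mulVmx. Qed.

(** Cramer's rule: expand the modified Plücker determinant along its replaced column [s]. The
    cofactors there are those of the pivot block, that is, entries of its adjugate. *)
Lemma colsub_last_graph v j : plucker v (first j) != 0 ->
  colsub (last j) (graph_mx v j) = ratio_mx v j.
Proof.
move=> /[dup] nz /pivot_unit u; rewrite /graph_mx -mulmx_colsub.
apply/matrixP => s t; rewrite /invmx u -scalemxAl !mxE /plucker_ratio !pluckerE.
rewrite mulrC; congr (_ / _); rewrite (expand_det_col _ s).
apply: eq_bigr => a _; rewrite !mxE /= eqxx mulrC; congr (_ * _).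
rewrite /cofactor; congr (_ * \det _); apply/matrixP => b c; rewrite !mxE /=.
by rewrite eq_sym (negPf (neq_lift _ _)).
Qed.

Lemma eqmx_graph v j : plucker v (first j) != 0 ->
  (graph_mx v j :=: basis_mx v)%MS.
Proof.
by move=> /pivot_unit u; apply: eqmxMfull; rewrite row_full_unit unitmx_inv.
Qed.

Section Embedding.
Hypothesis rn : (r <= n.+1)%N.
Variable j : 'S_n.+1.

(** Right multiplication by this matrix is the embedding x -> [0 | x], up to the order of the
    coordinates. *)
Definition last_mx : 'M[K]_(n.+1 - r, n.+1) := rowsub (last j) 1%:M.

Lemma last_idx_inj : injective (last j).
Proof.
move=> a b /perm_inj /(congr1 val) /=.
have lt (c : 'I_(n.+1 - r)) : (r + c < n.+1)%N by rewrite -ltn_subRL.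
by rewrite !inordK ?lt // => /addnI/val_inj.
Qed.

Lemma first_neq_last a b : first j a != last j b.
Proof.
apply/eqP => /perm_inj /(congr1 val) /=.
have ltb : (r + b < n.+1)%N by rewrite -ltn_subRL.
rewrite !inordK ?(leq_trans (ltn_ord a)) // => e.
by have := ltn_ord a; rewrite e ltnNge leq_addr.
Qed.

Lemma first_or_last i : (exists a, i = first j a) \/ (exists b, i = last j b).
Proof.
have -> : i = j (j^-1%g i) by rewrite permKV.
case: (ltnP (j^-1%g i) r) => [lt|le]; [left; exists (Ordinal lt)|right].
  by congr (j _); apply: val_inj; rewrite /= inordK.
have lt : (j^-1%g i - r < n.+1 - r)%N by rewrite ltn_sub2r // (leq_ltn_trans le).
exists (Ordinal lt); congr (j _); apply: val_inj => /=.
by rewrite subnKC // inordK.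
Qed.

Lemma colsub_last_mx m (A : 'M[K]_(m, _)) : colsub (last j) (A *m last_mx) = A.
Proof.
rewrite -mulmx_colsub; suff -> : colsub (last j) last_mx = 1%:M by rewrite mulmx1.
by apply/matrixP => a b; rewrite !mxE (inj_eq last_idx_inj).
Qed.

Lemma colsub_first_mx m (A : 'M[K]_(m, _)) : colsub (first j) (A *m last_mx) = 0.
Proof.
rewrite -mulmx_colsub; suff -> : colsub (first j) last_mx = 0 by rewrite mulmx0.
by apply/matrixP => a b; rewrite !mxE eq_sym (negPf (first_neq_last _ _)).
Qed.

Lemma eq_colsub m (A B : 'M[K]_(m, n.+1)) :
  colsub (first j) A = colsub (first j) B ->
  colsub (last j) A = colsub (last j) B -> A = B.
Proof.
move=> /matrixP ef /matrixP el; apply/matrixP => a i.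
by have [[b ->]|[b ->]] := first_or_last i;
  [have := ef a b | have := el a b]; rewrite !mxE.
Qed.

Lemma last_mx_free : row_free last_mx.
Proof.
by apply: inj_row_free => x x0; rewrite -(colsub_last_mx x) x0; apply/rowP => i; rewrite !mxE.
Qed.

End Embedding.
End Coordinates.

(** * Dimensions of the meet and the join of the conjugates *)

Section Degrees.
Variables (K : fieldType) (Gamma : set {rmorphism K -> K}).
Hypothesis hGamma : aut_subgroup Gamma.
Variables (n : nat) (X : set (proj_space K n)).
Hypothesis subX : is_subspace X.
Let k := invariant_field Gamma.
Let r := \dim (cone X).
Variables (v : r.-tuple 'rV[K]_n.+1) (j : 'S_n.+1).
Hypothesis vj : admissible v j.

Let P := graph_mx v j.
Let A := ratio_mx v j.
Let E := last_mx K r j.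

Let nz : plucker v (first_idx j) != 0. Proof. by case: vj. Qed.

Let coneE : cone X = rowvs P.
Proof.
by rewrite (eq_rowvs (eqmx_graph nz)); apply: rowvs_basis_mx; case: vj.
Qed.

Let XE : X = proj_image (rowvs P).
Proof. by rewrite -coneE; case: subX => U ->; rewrite coneK. Qed.

Let actE s : Gamma s -> proj_act s @` X = proj_image (rowvs (map_mx s P)).
Proof.
move=> /(aut_inv hGamma)[t [_ _ ts]].
by rewrite [in LHS]XE (proj_act_rowvs _ ts).
Qed.

Let P_free : row_free P.
Proof. by rewrite /row_free -dim_rowvs -coneE. Qed.

Let rn : (r <= n.+1)%N.
Proof. by rewrite -(eqP P_free) rank_leq_col. Qed.

Let P_first1 : colsub (first_idx j) P = 1%:M.
Proof. exact: colsub_first_graph. Qed.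

Let P_first (s : {rmorphism K -> K}) : colsub (first_idx j) (map_mx s P) = 1%:M.
Proof. by rewrite -map_mxsub P_first1 map_mx1. Qed.

(** All conjugates of [P] share the same identity block, so their differences live in the last
    coordinates. *)
Let map_graph (s : {rmorphism K -> K}) : map_mx s P - P = (map_mx s A - A) *m E.
Proof.
apply: (@eq_colsub _ n r j).
  rewrite colsub_first_mx //; apply/matrixP => a b.
  have /matrixP/(_ a b) := P_first s.
  have /matrixP/(_ a b) := P_first1; rewrite !mxE => -> ->.
  by rewrite subrr.
rewrite colsub_last_mx //; apply/matrixP => a b.
by rewrite /A -(colsub_last_graph nz) !mxE.
Qed.

Lemma proj_dim_meet :
  proj_dim (\bigcap_(s in Gamma) (proj_act s @` X)) = proj_dim X - coirr_at k v j.
Proof.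
have [C [CP Cdim]] := kdim_rational hGamma A.
have -> : coirr_at k v j = r%:Z - (\rank C)%:Z.
  rewrite -Cdim /coirr_at /cobracket.
  suff -> : (fun t : 'I_r => \row_s plucker_ratio v j t s) = rows A by [].
  by apply/funext => t; apply/rowP => s; rewrite !mxE.
have -> : \bigcap_(s in Gamma) (proj_act s @` X) = proj_image (rowvs (C *m P)).
  apply: eq_proj_set => x; split=> [xX|].
    have memx s : Gamma s -> (val x <= map_mx s P)%MS.
      by move=> Gs; have := xX s Gs; rewrite actE // => /proj_imageP; rewrite mem_rowvs.
    apply/proj_imageP; rewrite mem_rowvs.
    have /submxP[y ey] : (val x <= P)%MS.
      by have := memx _ (aut_id hGamma); rewrite map_mx_id.
    rewrite ey submxMr //; apply/CP => s Gs.
    have /submxP[z ez] := memx s Gs.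
    (* The pivot columns read off the coefficients, so y P = z s(P) forces y = z, and then y kills
       s(P) - P. *)
    have eyz : y = z.
      have : colsub (@first_idx n r j) (y *m P) =
             colsub (@first_idx n r j) (z *m map_mx s P).
        by rewrite -ey -ez.
      by rewrite -2!mulmx_colsub P_first P_first1 !mulmx1.
    apply/eqP; rewrite -(mulmx_free_eq0 _ (last_mx_free K r j)) -mulmxA.
    by rewrite -map_graph mulmxBr -ey eyz -ez subrr.
  move=> /proj_imageP; rewrite mem_rowvs => /submxP[y ey] s Gs.
  rewrite actE //; apply/proj_imageP; rewrite mem_rowvs ey mulmxA.
  have /CP/(_ _ Gs) yA : (y *m C <= C)%MS by exact: submxMl.
  suff -> : y *m C *m P = y *m C *m map_mx s P by exact: submxMl.
  by apply/esym/subr0_eq; rewrite -mulmxBr map_graph mulmxA yA mul0mx.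
rewrite [in RHS]XE !proj_dim_rowvs (eqP P_free) mxrankMfree //.
by rewrite opprB [RHS]addrC subrKA.
Qed.

Lemma proj_dim_join :
  proj_dim (join [set proj_act s @` X | s in Gamma]) = proj_dim X + irr_at k v j.
Proof.
have [C [CP Cdim]] := kdim_rational hGamma A^T.
have -> : irr_at k v j = (n.+1 - r)%N%:Z - (\rank C)%:Z.
  rewrite -Cdim /irr_at /bracket.
  suff -> : (fun t : 'I_(n.+1 - r) => \row_(s < r) plucker_ratio v j s t) = rows A^T by [].
  by apply/funext => t; apply/rowP => s; rewrite !mxE.
(* The row space of [C] is the orthogonal of all rows of the matrices s(A) - A; its own orthogonal
   [D] is therefore the span of these rows. *)
pose D := kermx C^T; pose W := (P + D *m E)%MS.
have CA s m (Y : 'M_(m, _)) : Gamma s ->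
    (Y <= C)%MS -> (map_mx s A - A) *m Y^T = 0.
  move=> Gs YC; apply: trmx_inj; rewrite trmx_mul trmxK trmx0.
  apply/row_matrixP => i; rewrite row_mul row0 linearB /= map_trmx.
  by apply: (CP _).1 => //; exact: submx_trans (row_sub i Y) YC.
have PW s : Gamma s -> (map_mx s P <= W)%MS.
  move=> Gs; rewrite -(subrK P (map_mx s P)) addrC addmx_sub_adds //.
  by rewrite map_graph submxMr // sub_kermx CA.
have -> : join [set proj_act s @` X | s in Gamma] = proj_image (rowvs W).
  apply/seteqP; split.
    apply: smallest_sub; first by exists (rowvs W).
    move=> p [_ [s Gs <-]]; rewrite actE //; apply: proj_image_mono.
    apply/subvP => x; rewrite !mem_rowvs => /submx_trans; apply; exact: PW.
  move=> p pW _ [[U ->]] XU; move: p pW; apply: proj_image_mono.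
  pose M := basis_mx (vbasis U).
  have UM : U = rowvs M by apply: rowvs_basis_mx; exact: vbasisP.
  have PM s : Gamma s -> (map_mx s P <= M)%MS.
    move=> Gs; apply: rowspace_le => x; rewrite -!mem_rowvs -UM.
    move: x; apply/subvP; apply: proj_image_sub => p pP; apply: XU.
    by exists (proj_act s @` X); [exists s | rewrite actE].
  have P1 : (P <= M)%MS by have := PM _ (aut_id hGamma); rewrite map_mx_id.
  apply/subvP => x; rewrite UM !mem_rowvs => /submx_trans; apply.
  rewrite addsmx_sub P1 /= submxE -mulmxA.
  (* The goal is D Y = 0. Since [M] contains the rows of [P] and s(P), (s(A) - A) Y = (s(P) - P)
     coker(M) vanishes, so the columns of [Y] lie in the row space of [C], which [D] annihilates. *)
  set Y := E *m cokermx M.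
  have /submxP[T eT] : (Y^T <= C)%MS.
    apply: rowspace_le => y /submxP[z ->]; apply/CP => s Gs.
    rewrite -mulmxA; suff -> : Y^T *m (map_mx s A^T - A^T) = 0 by rewrite mulmx0.
    rewrite -map_trmx -linearB -trmx_mul /= mulmxA -map_graph.
    suff /eqP -> : (map_mx s P - P) *m cokermx M == 0 by rewrite trmx0.
    by rewrite -submxE addmx_sub ?eqmx_opp ?PM.
  by rewrite -[Y]trmxK eT trmx_mul mulmxA mulmx_ker mul0mx.
rewrite [in RHS]XE !proj_dim_rowvs /W (mxrank_disjoint_sum _); last first.
  apply/eqP; rewrite -submx0; apply: rowspace_le => x.
  (* The sum is direct: in the pivot columns y P reads y, while the row space of D E reads 0. *)
  rewrite sub_capmx => /andP[/submxP[y ->] /submxP[z]].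
  rewrite mulmxA => /(congr1 (colsub (@first_idx n r j))).
  rewrite colsub_first_mx // -mulmx_colsub P_first1 mulmx1 => ->.
  by rewrite mul0mx sub0mx.
rewrite mxrankMfree ?last_mx_free // mxrank_ker mxrank_tr PoszD.
by rewrite -subzn ?rank_leq_row // addrAC.
Qed.

End Degrees.

Theorem mainTheorem1 (K : fieldType) (Gamma : set {rmorphism K -> K})
    (hGamma : aut_subgroup Gamma) (n : nat) :
  let k := invariant_field Gamma in
  (forall X : set (proj_space K n), is_subspace X ->
     forall (v w : (\dim (cone X)).-tuple 'rV[K]_n.+1) (i j : 'S_n.+1),
       admissible v i -> admissible w j ->
       irr_at k v i = irr_at k w j /\ coirr_at k v i = coirr_at k w j) /\
  (forall V : set (proj_space K n), is_subspace V ->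
     proj_dim (join [set proj_act s @` V | s in Gamma]) =
       proj_dim V + Irr k V /\
     proj_dim (\bigcap_(s in Gamma) (proj_act s @` V)) =
       proj_dim V - coIrr k V).
Proof.
move=> k; split=> [X sX v w i j vi wj|V sV].
  split; first by apply: (@addrI _ (proj_dim X)); rewrite -!(proj_dim_join hGamma).
  apply: oppr_inj; apply: (@addrI _ (proj_dim X)).
  by rewrite -!(proj_dim_meet hGamma).
have [v0 [j0 adm0]] := admissible_ex V; split.
  (* [xget] returns the value at some admissible choice, to which the formula applies; the default 0
     is excluded by the choice [v0], [j0]. *)
  rewrite /Irr; case: xgetP => [_ _ /= [v [j [adm ->]]]|/(_ (irr_at k v0 j0))[]].
    exact: proj_dim_join.
  by exists v0, j0.
rewrite /coIrr; case: xgetP => [_ _ /= [v [j [adm ->]]]|/(_ (coirr_at k v0 j0))[]].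
  exact: proj_dim_meet.
by exists v0, j0.
Qed.
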